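(* In the setting of global sequences obtained by patching local ones given in the context, assume that, for every $T$ and every index $j$: (A1) $\hat R_{j,T}:X_{j,T}\to\hat X_{j,T}$ is continuous, with operator norm $\|\hat R_{j,T}\|$; (A2) $E_{j,T}\hat I_{j,T}x_p=I_{j,T}x_p$ for all $x_p\in\mathcal P_T^{k_j}$; (A3) $I_{j,T}:\mathcal H_{j,T}\to X_{j,T}$ is continuous for the norms $\|\cdot\|_{\mathcal H,j,T}$ and $\|\cdot\|_{X,j,T}$, with operator norm $\|I_{j,T}\|$; and that, for the global complex, (C3) $\hat R_{j+1}d_j=\hat d_j\hat R_j$ and $E_{j+1}\hat d_j=d_jE_j$ for all $j$. Fix an index $i$ and an unbounded linear operator $D_i^*:\mathcal L_{i+1}\to\mathcal L_i$ with domain $\mathrm{dom}(D_i^* )$. Let $u\in\mathcal H_{i+1}\cap\mathrm{dom}(D_i^* )$ and define $$\mathcal E_i(u):=\sup_{x\in X_i\setminus\{0\}}\frac{(I_{i+1}u,d_ix)_{X,i+1}+\sum_T(D_i^*u,P_{i,T}x)_{\mathcal L,i,T}}{\|x\|_{X,i}+\|d_ix\|_{X,i+1}},$$ $$\hat{\mathcal E}_i(u):=\sup_{\hat x\in\hat X_i\setminus\{0\}}\frac{(\hat I_{i+1}u,\hat d_i\hat x)_{\hat X,i+1}+\sum_T(D_i^*u,\hat P_{i,T}\hat x)_{\mathcal L,i,T}}{\|\hat x\|_{\hat X,i}+\|\hat d_i\hat x\|_{\hat X,i+1}}.$$ Then $$\hat{\mathcal E}_i(u)\le\mathcal E_i(u)+\left(\sum_T\left(\|\hat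 R_{i+1,T}\|+1\right)^2\|I_{i+1,T}\|^2\,\omega_{i+1,T}(u)^2\right)^{1/2},$$ where $\omega_{i+1,T}(u):=\inf_{u_p\in\mathcal P_T^{k_{i+1}}}\|u-u_p\|_{\mathcal H,i+1,T}$.
   Context: $T$ ranges over a finite set (the elements of a mesh). Local objects. For each $T$: $(X_{i,T},d_{i,T})_i$ is a complex of real vector spaces with inner products $(\cdot,\cdot)_{X,i,T}$ and norms $\|\cdot\|_{X,i,T}$; $(\hat X_{i,T})_i$ is a second sequence of real vector spaces, with linear maps $E_{i,T}:\hat X_{i,T}\to X_{i,T}$ (extensions) and $\hat R_{i,T}:X_{i,T}\to\hat X_{i,T}$ (reductions); the inner product on $\hat X_{i,T}$ is $(\hat x,\hat y)_{\hat X,i,T}:=(E_{i,T}\hat x,E_{i,T}\hat y)_{X,i,T}$, with norm $\|\hat x\|_{\hat X,i,T}=\|E_{i,T}\hat x\|_{X,i,T}$ (it is understood that this is an inner product). $\mathcal H_{i,T}$ is a Hilbert space with norm $\|\cdot\|_{\mathcal H,i,T}$, continuously embedded in an ''$L^2$-like'' space $\mathcal L_{i,T}$ with inner product $(\cdot,\cdot)_{\mathcal L,i,T}$; $\mathcal P_T^{k_i}\subset\mathcal H_{i,T}$ is a (polynomial) linear subspace; $I_{i,T}:\mathcal H_{i,T}\to X_{i,T}$ is linear (interpolator) and $\hat I_{i,T}:=\hat R_{i,T}I_{i,T}$; $P_{i,T}:X_{i,T}\to\mathcal P_T^{k_i}$ is linear (potential reconstruction) and $\hat P_{i,T}:=P_{i,T}E_{i,T}$.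 Global objects. The global spaces $X_i$, $\hat X_i$, $\mathcal H_i$, $\mathcal L_i$ come with linear restriction maps to their local counterparts (written $x\mapsto x_T$), with $\mathcal H_i\subset\mathcal L_i$. The global linear maps $d_i:X_i\to X_{i+1}$ (forming a complex), $E_i:\hat X_i\to X_i$, $\hat R_i:X_i\to\hat X_i$, $I_i:\mathcal H_i\to X_i$ are obtained by patching the local ones, i.e. their restriction to $T$ is the corresponding local map applied to the restriction of the argument; $\hat d_i:=\hat R_{i+1}d_iE_i$ and $\hat I_i:=\hat R_iI_i$. The global inner products are sums of the local ones: $(x,y)_{X,i}=\sum_T(x_T,y_T)_{X,i,T}$ and $(\hat x,\hat y)_{\hat X,i}=\sum_T(\hat x_T,\hat y_T)_{\hat X,i,T}=(E_i\hat x,E_i\hat y)_{X,i}$, with associated norms $\|\cdot\|_{X,i}$ and $\|\cdot\|_{\hat X,i}$. When a local object is applied to a global argument, restriction to $T$ is implied (e.g. $P_{i,T}x=P_{i,T}x_T$, $(D_i^*u,\cdot)_{\mathcal L,i,T}=((D_i^*u)_T,\cdot)_{\mathcal L,i,T}$, $\|u-u_p\|_{\mathcal H,i+1,T}=\|u_T-u_p\|_{\mathcal H,i+1,T}$). *)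

(* Defs.v *)
From HB Require Import structures.
From mathcomp Require Import all_boot all_order all_algebra sesquilinear.
From mathcomp Require Import all_classical all_reals all_analysis.

Set Implicit Arguments.
Unset Strict Implicit.
Unset Printing Implicit Defensive.
Import Order.TTheory GRing.Theory Num.Theory numFieldNormedType.Exports.

Local Open Scope classical_set_scope.
Local Open Scope ring_scope.

HB.mixin Record NormedModule_isInnerSpace (R : realType) V
    of NormedModule R V := {
  inner : {dot V for (@idfun R)} ;
  inner_norm : forall x : V, inner x x = `|x| ^+ 2
}.

(* Real inner product spaces, not assumed complete; the norm (and hence the
   topology) is the one induced by the inner product. *)
#[short(type="innerSpaceType")]
HB.structure Definition InnerSpace (R : realType) :=
  { V of NormedModule R V & NormedModule_isInnerSpace R V }.

#[short(type="hilbertType")]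
HB.structure Definition Hilbert (R : realType) :=
  { V of InnerSpace R V & CompleteNormedModule R V }.

(* This is the operator norm when f is linear and continuous; when the
   supremum is infinite, the real-valued sup is the junk value 0. *)
Definition opnorm (R : realType) (V W : normedModType R) (f : V -> W) : R :=
  sup [set `|f x| | x in [set x : V | `|x| <= 1]].

(* Linear operator from U to V defined on a linear subspace of U. The values of
   uop_fun outside of uop_dom are meaningless. *)
Record unbounded_operator (R : realType) (U V : lmodType R) := UnboundedOperator {
  uop_dom : submodClosed U ;
  uop_fun :> U -> V ;
  uop_linear : forall a : R, {in uop_dom &, forall x y,
    uop_fun (a *: x + y) = a *: uop_fun x + uop_fun y}
}.

(* The objects attached to one mesh element. Sequences are indexed by int; a
   sequence indexed by an interval of integers is extended by zero spaces.
   The inclusion of lH j in lL j is represented by the injection lemb. *)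
Record local_sequence (R : realType) := LocalSequence {
  lX : int -> innerSpaceType R ;
  ld : forall j, {linear lX j -> lX (j + 1)} ;
  ld_complex : forall j (x : lX j), ld (j + 1) (ld j x) = 0 ;

  lXh : int -> innerSpaceType R ;
  lE : forall j, {linear lXh j -> lX j} ;
  lRh : forall j, {linear lX j -> lXh j} ;
  lXh_inner : forall j (x y : lXh j),
    inner x y = inner (lE j x) (lE j y) ;

  lH : int -> hilbertType R ;
  lL : int -> innerSpaceType R ;
  lemb : forall j, {linear lH j -> lL j} ;
  lemb_inj : forall j, injective (lemb j) ;
  lemb_continuous : forall j, continuous (lemb j) ;

  lPoly : forall j, submodClosed (lH j) ;
  lI : forall j, {linear lH j -> lX j} ;
  lP : forall j, {linear lX j -> lH j} ;
  lP_poly : forall j (x : lX j), lP j x \in lPoly j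
}.

Definition lIh R (S : local_sequence R) j (v : lH S j) : lXh S j :=
  lRh S j (lI S j v).

Definition lPh R (S : local_sequence R) j (x : lXh S j) : lH S j :=
  lP S j (lE S j x).

(* The global objects obtained by patching the local ones over the mesh T; the
   maps gresX, gresXh, gresH and gresL are the restrictions x |-> x_t. *)
Record global_sequence (R : realType) (T : finType)
    (S : T -> local_sequence R) := GlobalSequence {
  gX : int -> innerSpaceType R ;
  gXh : int -> innerSpaceType R ;
  gH : int -> lmodType R ;
  gL : int -> lmodType R ;

  gresX : forall j t, {linear gX j -> lX (S t) j} ;
  gresXh : forall j t, {linear gXh j -> lXh (S t) j} ;
  gresH : forall j t, {linear gH j -> lH (S t) j} ;
  gresL : forall j t, {linear gL j -> lL (S t) j} ;

  gX_inner : forall j (x y : gX j),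
    inner x y = \sum_(t : T) inner (gresX j t x) (gresX j t y) ;
  gXh_inner : forall j (x y : gXh j),
    inner x y = \sum_(t : T) inner (gresXh j t x) (gresXh j t y) ;

  gemb : forall j, {linear gH j -> gL j} ;
  gemb_inj : forall j, injective (gemb j) ;
  gemb_patch : forall j t (v : gH j),
    gresL j t (gemb j v) = lemb (S t) j (gresH j t v) ;

  gd : forall j, {linear gX j -> gX (j + 1)} ;
  gd_complex : forall j (x : gX j), gd (j + 1) (gd j x) = 0 ;
  gd_patch : forall j t (x : gX j),
    gresX (j + 1) t (gd j x) = ld (S t) j (gresX j t x) ;

  gE : forall j, {linear gXh j -> gX j} ;
  gE_patch : forall j t (x : gXh j),
    gresX j t (gE j x) = lE (S t) j (gresXh j t x) ;

  gRh : forall j, {linear gX j -> gXh j} ;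
  gRh_patch : forall j t (x : gX j),
    gresXh j t (gRh j x) = lRh (S t) j (gresX j t x) ;

  gI : forall j, {linear gH j -> gX j} ;
  gI_patch : forall j t (v : gH j),
    gresX j t (gI j v) = lI (S t) j (gresH j t v)
}.

Section GlobalSequence.
Variables (R : realType) (T : finType) (S : T -> local_sequence R).
Variable G : global_sequence S.

Definition gdh j (x : gXh G j) : gXh G (j + 1) :=
  gRh G (j + 1) (gd G j (gE G j x)).

Definition gIh j (v : gH G j) : gXh G j := gRh G j (gI G j v).

Section AdjointConsistency.
Variables (i : int) (D : unbounded_operator (gL G (i + 1)) (gL G i)).

(* The suprema are taken in the extended reals: they may be +oo, since no
   boundedness is required of the potential reconstructions. *)
Definition adj_error (u : gH G (i + 1)) : \bar R :=
  ereal_sup [set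
    ((inner (gI G (i + 1) u) (gd G i x) +
      \sum_(t : T) inner (gresL G i t (D (gemb G (i + 1) u)))
                         (lemb (S t) i (lP (S t) i (gresX G i t x))))
     / (`|x| + `|gd G i x|))%:E
    | x in [set x : gX G i | x != 0]].

Definition adj_errorh (u : gH G (i + 1)) : \bar R :=
  ereal_sup [set
    ((inner (gIh u) (gdh x) +
      \sum_(t : T) inner (gresL G i t (D (gemb G (i + 1) u)))
                         (lemb (S t) i (lPh (gresXh G i t x))))
     / (`|x| + `|gdh x|))%:E
    | x in [set x : gXh G i | x != 0]].

End AdjointConsistency.

Definition best_approx j t (u : gH G j) : R :=
  inf [set `|gresH G j t u - p| | p in [set p | p \in lPoly (S t) j]].

End GlobalSequence.

(* Main.v *)
(* A nonzero xh is tested against x := E xh: the defining relation of the inner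
   product on Xh makes E an isometry, and it commutes with the differentials, so
   both quotients have the same denominator and the same potential term. The
   numerators differ by (E Ih u - I u, d x), which Cauchy-Schwarz bounds by
   |E Ih u - I u| times the denominator. Elementwise E Ih - I vanishes on
   polynomials, so it sees only the distance from u to the polynomial space. *)
Require Import Defs.
From HB Require Import structures.
From mathcomp Require Import all_boot all_order all_algebra sesquilinear.
From mathcomp Require Import all_classical all_reals all_analysis.
From mathcomp Require Import lra.

Set Implicit Arguments.
Unset Strict Implicit.
Unset Printing Implicit Defensive.
Import Order.TTheory GRing.Theory Num.Theory numFieldNormedType.Exports.

Local Open Scope classical_set_scope.
Local Open Scope ring_scope.

Section InnerSpace.
Context {R : realType}.

Lemma innerC (V : innerSpaceType R) (x y : V) : inner x y = inner y x.
Proof. by rewrite hermC expr0 mul1r. Qed.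

(** Cauchy-Schwarz: the squared norm of [|y| x - |x| y] expands to
    [2 |x| |y| (|x| |y| - inner x y)], and the positive factor is cancelled. *)
Lemma inner_le_norm (V : innerSpaceType R) (x y : V) :
  inner x y <= `|x| * `|y|.
Proof.
have [->|x0] := eqVneq x 0; first by rewrite linear0l normr0 mul0r.
have [->|y0] := eqVneq y 0; first by rewrite linear0r normr0 mulr0.
have xy0 : 0 < `|x| * `|y| by rewrite mulr_gt0 ?normr_gt0.
have : 0 <= inner (`|y| *: x - `|x| *: y) (`|y| *: x - `|x| *: y).
  by rewrite inner_norm sqr_ge0.
rewrite linearBl !linearBr !linearZl !linearZr /= !inner_norm (innerC y x) => h.
by rewrite -(ler_pM2l xy0); lra.
Qed.

Lemma norm_inner (V W : innerSpaceType R) (x : V) (y : W) :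
  inner x x = inner y y -> `|x| = `|y|.
Proof.
by rewrite !inner_norm => /eqP; rewrite eqrXn2// => /eqP.
Qed.

End InnerSpace.

Section OperatorNorm.
Context {R : realType} {V W : normedModType R}.

(** Continuity ensures that the [sup] in [opnorm] is a genuine supremum and not its default value
    0. *)
Lemma opnorm_has_ubound (f : {linear V -> W}) : continuous f ->
  has_ubound [set `|f x| | x in [set x : V | `|x| <= 1]].
Proof.
move=> /linear_bounded_continuous/bounded_funP/(_ 1)[M fM].
by exists M => _ [x x1 <-]; exact: fM.
Qed.

Lemma opnorm_ge0 (f : {linear V -> W}) : continuous f -> 0 <= opnorm f.
Proof.
move=> /opnorm_has_ubound fub; apply: ub_le_sup => //.
by exists 0; rewrite /= ?linear0 normr0.
Qed.

Lemma opnormP (f : {linear V -> W}) (x : V) : continuous f ->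
  `|f x| <= opnorm f * `|x|.
Proof.
move=> fc; have [->|x0] := eqVneq x 0; first by rewrite linear0 !normr0 mulr0.
have nx0 : 0 < `|x| by rewrite normr_gt0.
have xV : `| `|x|^-1 | = `|x|^-1 by rewrite ger0_norm ?invr_ge0.
rewrite -ler_pdivrMr// mulrC -{1}xV -normrZ -linearZ.
apply: ub_le_sup; first exact: opnorm_has_ubound.
by exists (`|x|^-1 *: x) => //=; rewrite normrZ xV mulVf ?gt_eqF.
Qed.

End OperatorNorm.

Lemma le_mul_inf {R : realType} (A : set R) (a c : R) :
  A !=set0 -> 0 <= c -> (forall r, A r -> a <= c * r) -> a <= c * inf A.
Proof.
move=> A0; rewrite le_eqVlt => /predU1P[<-|c0] aA.
  (* The case [c = 0] cannot be reached by division; any one element of [A] gives [a <= 0]. *)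
  by have [r /aA] := A0; rewrite !mul0r.
rewrite mulrC -ler_pdivrMr//; apply: lb_le_inf => // r /aA.
by rewrite ler_pdivrMr// mulrC.
Qed.

Section LocalSequence.
Context {R : realType} {S : local_sequence R}.

Lemma norm_lE j (x : lXh S j) : `|lE S j x| = `|x|.
Proof. by apply: norm_inner; rewrite lXh_inner. Qed.

(** The error [E Ih - I] vanishes at [p], so [v] may be replaced by [w := v - p]. As [E] is an
    isometry, [E Ih w] has the norm of [Rh (I w)], whence the factor [opnorm Rh]; the summand 1
    accounts for [I w] itself. *)
Lemma norm_lE_lIh_sub j (v p : lH S j) :
  continuous (lRh S j) -> continuous (lI S j) ->
  lE S j (lIh p) = lI S j p ->
  `|lE S j (lIh v) - lI S j v| <=
    (opnorm (lRh S j) + 1) * opnorm (lI S j) * `|v - p|.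
Proof.
move=> Rc Ic Ep.
have -> : lE S j (lIh v) - lI S j v =
    lE S j (lIh (v - p)) - lI S j (v - p).
  move: Ep; rewrite /lIh !linearB /= => ->.
  by rewrite opprK addrACA addNr addr0.
rewrite (le_trans (ler_normB _ _))// norm_lE.
rewrite (le_trans (lerD (opnormP _ Rc) (lexx _)))//.
rewrite -{2}(mul1r `|lI S j _|) -mulrDl -mulrA ler_wpM2l ?opnormP//.
by rewrite addr_ge0 ?opnorm_ge0.
Qed.

End LocalSequence.

Section GlobalSequence.
Context {R : realType} {T : finType} {S : T -> local_sequence R}.
Context {G : global_sequence S}.

Lemma inner_gE j (x y : gXh G j) :
  inner (gE G j x) (gE G j y) = inner x y.
Proof.
rewrite gX_inner gXh_inner; apply: eq_bigr => t _.
by rewrite !gE_patch lXh_inner.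
Qed.

Lemma norm_gE j (x : gXh G j) : `|gE G j x| = `|x|.
Proof. by apply: norm_inner; rewrite inner_gE. Qed.

Lemma norm_gE_gIh_sub j (u : gH G j) :
  (forall t, continuous (lRh (S t) j)) -> (forall t, continuous (lI (S t) j)) ->
  (forall t (p : lH (S t) j), p \in lPoly (S t) j ->
     lE (S t) j (lIh p) = lI (S t) j p) ->
  `|gE G j (gIh u) - gI G j u| <=
    Num.sqrt (\sum_(t : T) (opnorm (lRh (S t) j) + 1) ^+ 2 *
                           opnorm (lI (S t) j) ^+ 2 * best_approx t u ^+ 2).
Proof.
move=> Rc Ic EI.
(* It is the squared norm that splits into a sum over the mesh, so the bound is proved element by
   element on squares. *)
rewrite -[leLHS]ger0_norm// -sqrtr_sqr ler_wsqrtr// -inner_norm gX_inner.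
apply: ler_sum => t _; rewrite inner_norm -!exprMn.
have -> : gresX G j t (gE G j (gIh u) - gI G j u) =
    lE (S t) j (lIh (gresH G j t u)) - lI (S t) j (gresH G j t u).
  by rewrite linearB /= gE_patch gRh_patch gI_patch.
have C0 : 0 <= (opnorm (lRh (S t) j) + 1) * opnorm (lI (S t) j).
  exact: mulr_ge0 (addr_ge0 (opnorm_ge0 (Rc t)) ler01) (opnorm_ge0 (Ic t)).
apply: lerXn2r; rewrite ?nnegrE//; last first.
  apply: le_mul_inf => // [|_ [p pP <-]].
    (* The zero polynomial shows that the infimum is taken over a nonempty set. *)
    by exists `|gresH G j t u - 0|, 0 => //=; rewrite rpred0.
  by apply: norm_lE_lIh_sub => //; exact: EI.
rewrite mulr_ge0// lb_le_inf//.
  by exists `|gresH G j t u - 0|, 0 => //=; rewrite rpred0.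
by move=> _ [p _ <-].
Qed.

End GlobalSequence.

Theorem proposition10 (R : realType) (T : finType) (S : T -> local_sequence R)
    (G : global_sequence S)
    (A1 : forall t j, continuous (lRh (S t) j))
    (A2 : forall t j (xp : lH (S t) j), xp \in lPoly (S t) j ->
       lE (S t) j (lIh xp) = lI (S t) j xp)
    (A3 : forall t j, continuous (lI (S t) j))
    (C3R : forall j (x : gX G j), gRh G (j + 1) (gd G j x) = gdh (gRh G j x))
    (C3E : forall j (x : gXh G j), gE G (j + 1) (gdh x) = gd G j (gE G j x))
    (i : int) (D : unbounded_operator (gL G (i + 1)) (gL G i))
    (u : gH G (i + 1)) (hu : gemb G (i + 1) u \in uop_dom D) :
  (adj_errorh D u <=
   adj_error D u +
   (Num.sqrt (\sum_(t : T)
      (opnorm (lRh (S t) (i + 1)) + 1) ^+ 2 *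
      opnorm (lI (S t) (i + 1)) ^+ 2 *
      best_approx t u ^+ 2))%:E)%E.
Proof.
apply: ge_ereal_sup => _ [x /= x0 <-].
have dE : gE G (i + 1) (gdh x) = gd G i (gE G i x) by exact: C3E.
(* Being an isometry, [gE] sends [x] to an admissible test vector for [adj_error]. *)
have Ex0 : gE G i x != 0 by rewrite -normr_gt0 norm_gE normr_gt0.
have n0 : 0 < `|x| + `|gdh x| by rewrite ltr_wpDr// normr_gt0.
set e := Num.sqrt _.
have Ee : `|gE G (i + 1) (gIh u) - gI G (i + 1) u| <= e.
  by apply: norm_gE_gIh_sub => // t p; exact: A2.
pose s := \sum_(t : T) inner (gresL G i t (D (gemb G (i + 1) u)))
                         (lemb (S t) i (lPh (gresXh G i t x))).
apply: (@le_trans _ _ (((inner (gI G (i + 1) u) (gd G i (gE G i x)) + s)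
     / (`|x| + `|gdh x|))%:E + e%:E)%E); last first.
  rewrite leeD2r//; apply: ereal_sup_ubound; exists (gE G i x) => //=.
  rewrite -dE !norm_gE; congr ((_ + _) / _)%:E.
  by apply: eq_bigr => t _; rewrite gE_patch.
rewrite -EFinD lee_fin ler_pdivrMr// mulrDl divfK ?gt_eqF//.
(* The potential terms [s] cancel; moving the reduced inner product through [gE] gives both
   remaining ones the same second argument. *)
rewrite addrAC lerD2r -inner_gE dE -lerBlDl -linearBl.
rewrite (le_trans (inner_le_norm _ _))// -dE norm_gE.
(* Cauchy-Schwarz leaves only the factor [|gdh x|], which is at most the full denominator. *)
by rewrite ler_pM// lerDr.
Qed.
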